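(* Suppose the Markov chain on the countable set $V$ is irreducible and recurrent, and let $\pi:V\to(0,\infty)$ be a stationary vector (so $\sum_{u}\pi(u)p(u,v)=\pi(v)$ for all $v$). Let $b\neq c$ be vertices, and let $h(v):=\mathbb{P}_v(T_b<T_c)$. Suppose that the quantity $$K_3:=1+\frac12\Big(d(b)+d(c)+\sum_{u,v\in V} d(u)\,p(u,v)\,|h(u)-h(v)|\Big)$$ is finite. Then for any rotor walk $x_0,x_1,\ldots$ associated with the chain (any initial vertex and any initial rotor configuration) and for all $t$, $$\Big|\frac{n_t(b)}{\pi(b)}-\frac{n_t(c)}{\pi(c)}\Big|\leq \frac{K_3}{\pi(b)\,e_{b,c}},$$ where $e_{b,c}:=\mathbb{P}_b(T_c<T_b^+)$.
   Context: Markov chain: $V$ is a countable set and $p:V\times V\to[0,1]$ are the transition probabilities of a Markov chain $X_0,X_1,\ldots$ on $V$; all $p(u,v)$ are rational, and for each $u$ there are only finitely many $v$ with $p(u,v)>0$. $\mathbb{P}_u$ is the law of the chain started at $X_0=u$. $T_v:=\min\{t\ge 0: X_t=v\}$ and $T_v^+:=\min\{t\ge 1: X_t=v\}$, with $\min\emptyset:=\infty$. Rotor mechanism: to each vertex $u$ are associated a positive integer $d(u)$ and a finite sequence of (not necessarily distinct) vertices $u^{(1)},\ldots,u^{(d(u))}$ (the successors of $u$) such that $p(u,v)=\#\{i:u^{(i)}=v\}/d(u)$ for all $u,v\in V$. Rotor walk: a rotor configuration is a map $r$ assigning to each $v\in V$ an integer $r(v)\in\{1,\ldots,d(v)\}$.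 Given an initial vertex $x_0$ and an initial rotor configuration $r_0$, the rotor walk is defined inductively: $r_{t+1}(v)=r_t(v)$ for $v\ne x_t$; $r_{t+1}(x_t)=r_t(x_t)+1$ if $r_t(x_t)<d(x_t)$ and $r_{t+1}(x_t)=1$ if $r_t(x_t)=d(x_t)$; and $x_{t+1}:=(x_t)^{(r_{t+1}(x_t))}$. $n_t(v):=\#\{s\in\{0,\ldots,t-1\}: x_s=v\}$. *)

(* Defs.v *)
From HB Require Import structures.
From mathcomp Require Import all_boot all_order all_algebra.
From mathcomp Require Import all_classical all_reals all_analysis.
Set Implicit Arguments.
Unset Strict Implicit.
Unset Printing Implicit Defensive.
Import Order.TTheory GRing.Theory Num.Theory.
Local Open Scope classical_set_scope.
Local Open Scope ring_scope.
Local Open Scope ereal_scope.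

Record transition_probabilities (R : realType) (V : countType)
    (p : V -> V -> R) : Prop := {
  tp_ge0 : forall u v, (0 <= p u v)%R ;
  tp_le1 : forall u v, (p u v <= 1)%R ;
  tp_sum1 : forall u, \esum_(v in [set: V]) (p u v)%:E = 1 ;
  tp_rational : forall u v, rational (p u v) ;
  tp_finite_support : forall u, finite_set [set v | (0 < p u v)%R]
}.

(* [P u] is the law under which the process [X] is the Markov chain with
   transition probabilities [p] started at [u]; measurability is with respect
   to the discrete sigma-algebra on [V], and the Markov property is the
   conditional probability statement with its denominator cleared. *)
Record markov_chain (R : realType) (V : countType) (p : V -> V -> R)
    (d0 : measure_display) (Omega : measurableType d0)
    (P : V -> probability Omega R) (X : nat -> Omega -> V) : Prop := {
  mc_measurable : forall n (A : set V), measurable (X n @^-1` A) ;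
  mc_start : forall u, P u [set w | X 0%N w = u] = 1 ;
  mc_step : forall u n (v : nat -> V),
    P u [set w | forall k, (k <= n.+1)%N -> X k w = v k] =
    P u [set w | forall k, (k <= n)%N -> X k w = v k] * (p (v n) (v n.+1))%:E
}.

(* [hitting_from s] is min {t >= s | X_t = v}, with min set0 = +oo:
   T_v is the case s = 0 and T_v^+ the case s = 1. *)
Definition hitting_from (R : realType) (V : countType) (Omega : Type)
    (s : nat) (X : nat -> Omega -> V) (v : V) (w : Omega) : \bar R :=
  ereal_inf [set (t%:R : R)%:E | t in [set t | (s <= t)%N /\ X t w = v]].

Definition hitting_time (R : realType) (V : countType) (Omega : Type)
    (X : nat -> Omega -> V) (v : V) (w : Omega) : \bar R :=
  hitting_from R 0%N X v w.

Definition return_time (R : realType) (V : countType) (Omega : Type)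
    (X : nat -> Omega -> V) (v : V) (w : Omega) : \bar R :=
  hitting_from R 1%N X v w.

Section Chain.
Context (R : realType) (V : countType) (d0 : measure_display)
  (Omega : measurableType d0) (P : V -> probability Omega R)
  (X : nat -> Omega -> V).

Definition irreducible_chain : Prop :=
  forall u v, exists n, 0 < P u [set w | X n w = v].

Definition recurrent_chain : Prop :=
  forall u, P u [set w | return_time R X u w < +oo] = 1.

Definition hit_before (b c v : V) : R :=
  fine (P v [set w | hitting_time R X b w < hitting_time R X c w]).

Definition escape_probability (b c : V) : R :=
  fine (P b [set w | hitting_time R X c w < return_time R X b w]).

End Chain.

Definition stationary_vector (R : realType) (V : countType) (p : V -> V -> R)
    (pi : V -> R) : Prop :=
  (forall v, (0 < pi v)%R) /\
  forall v, \esum_(u in [set: V]) (pi u * p u v)%:E = (pi v)%:E.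

(* The i-th successor of [u], for 1 <= i <= d u, is entry [i.-1] of [succ u]. *)
Definition rotor_mechanism (R : realType) (V : countType) (p : V -> V -> R)
    (d : V -> nat) (succ : forall u, (d u).-tuple V) : Prop :=
  (forall u, (0 < d u)%N) /\
  forall u v, p u v =
    (#|[pred i : 'I_(d u) | tnth (succ u) i == v]|%:R / (d u)%:R)%R.

Definition rotor_configuration (V : countType) (d r : V -> nat) : Prop :=
  forall v, (1 <= r v <= d v)%N.

Section RotorWalk.
Context (V : countType) (d : V -> nat) (succ : forall u, (d u).-tuple V).

Definition rotor_step (xr : V * (V -> nat)) : V * (V -> nat) :=
  let: (x, r) := xr in
  let r' := fun v =>
    if v == x then (if (r x < d x)%N then (r x).+1 else 1%N) else r v in
  (* the default value is never used on a rotor configuration *)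
  (nth x (succ x) (r' x).-1, r').

Definition rotor_walk (x0 : V) (r0 : V -> nat) (t : nat) : V :=
  (iter t rotor_step (x0, r0)).1.

End RotorWalk.

Definition visits (V : countType) (x : nat -> V) (t : nat) (v : V) : nat :=
  #|[pred s : 'I_t | x s == v]|.

Definition K3 (R : realType) (V : countType) (p : V -> V -> R)
    (d : V -> nat) (h : V -> R) (b c : V) : \bar R :=
  1 + (2^-1)%:E * ((d b)%:R%:E + (d c)%:R%:E +
    \esum_(uv in [set: V * V])
       ((d uv.1)%:R * p uv.1 uv.2 * `|h uv.1 - h uv.2|)%:E).

(* Main.v *)
(* Let h(v) = P_v(T_b < T_c) and let P also denote the transition operator. The
   drift Ph - h vanishes off {b, c}, with Ph(b) - h(b) = - e_{b,c} and
   Ph(c) - h(c) = e_{c,b}. Give the rotor at u pointing to its r-th successor the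
   weight sum_{i <= r} (h(u) - h(u^(i)) + Ph(u) - h(u)). At each step of the walk
   the total weight plus h(x_t) grows by exactly the drift at x_t, and the weight
   at u varies by at most half the sum of the absolute values of its increments,
   since these sum to zero over a full turn. Hence
   |n_t(c) e_{c,b} - n_t(b) e_{b,c}| <= K_3.

   It remains that pi(b) e_{b,c} = pi(c) e_{c,b}. With h_n(v) = P_v(T_b < T_c,
   T_b <= n), which is summable against pi, stationarity gives
   sum pi Ph_n = sum pi h_n, and Ph_n >= h_n off {b, c} then yields
   pi(c) Ph_n(c) <= pi(b) (1 - Ph_n(b)). Letting n go to infinity gives
   pi(c) e_{c,b} <= pi(b) e_{b,c}, and equality follows by exchanging b and c. *)

Require Import Defs.
From HB Require Import structures.
From mathcomp Require Import all_boot all_order all_algebra.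
From mathcomp Require Import all_classical all_reals all_analysis.
From mathcomp Require Import ring lra.
Set Implicit Arguments.
Unset Strict Implicit.
Unset Printing Implicit Defensive.
Import Order.TTheory GRing.Theory Num.Theory.
Import numFieldNormedType.Exports.
Local Open Scope classical_set_scope.
Local Open Scope ring_scope.

(** * The transition operator as an average over successors *)

Section SuccessorMean.
Context (R : realType) (V : countType) (d : V -> nat)
  (succ : forall u, (d u).-tuple V).

(** The transition operator of the chain applied to [f], written as a finite average so that limits
    and linearity raise no question of summability. *)
Definition successor_mean (f : V -> R) (v : V) : R :=
  (\sum_(i < d v) f (tnth (succ v) i)) / (d v)%:R.

Lemma ler_successor_mean f g v :
  (forall u, f u <= g u) -> successor_mean f v <= successor_mean g v.
Proof.
by move=> fg; rewrite ler_wpM2r ?invr_ge0// ler_sum.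
Qed.

Lemma successor_mean_ge0 f v : (forall u, 0 <= f u) -> 0 <= successor_mean f v.
Proof. by move=> f0; rewrite divr_ge0// sumr_ge0. Qed.

Lemma successor_mean_eq0 f v : (forall u, 0 <= f u) -> successor_mean f v = 0 ->
  forall i, f (tnth (succ v) i) = 0.
Proof.
move=> f0 /eqP; rewrite mulf_eq0 invr_eq0 pnatr_eq0 => /orP[|/eqP dv0 i]; last first.
  by have := ltn_ord i; rewrite [X in (_ < X)%N]dv0.
by rewrite psumr_eq0// => /allP s0 i; apply/eqP/s0; rewrite mem_index_enum.
Qed.

Lemma cvg_successor_mean (f : nat -> V -> R) (g : V -> R) v :
  (forall u, f n u @[n --> \oo] --> g u) ->
  successor_mean (f n) v @[n --> \oo] --> successor_mean g v.
Proof.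
move=> fg; apply: cvgM; last exact: cvg_cst.
by apply: cvg_big => [|i _]; [exact: add_continuous|exact: fg].
Qed.

Hypothesis d_gt0 : forall u, (0 < d u)%N.

Lemma sum_successors f v :
  \sum_(i < d v) f (tnth (succ v) i) = (d v)%:R * successor_mean f v.
Proof.
by rewrite mulrC divfK// pnatr_eq0 -lt0n.
Qed.

Lemma successor_mean1 v : successor_mean (fun=> 1) v = 1.
Proof.
by rewrite /successor_mean sumr_const card_ord divff// pnatr_eq0 -lt0n.
Qed.

Lemma successor_mean_le1 f v : (forall u, f u <= 1) -> successor_mean f v <= 1.
Proof. by move=> f1; rewrite -[leRHS](successor_mean1 v) ler_successor_mean. Qed.

Context (p : V -> V -> R).
Hypothesis pE : forall u v, p u v =
  #|[pred i : 'I_(d u) | tnth (succ u) i == v]|%:R / (d u)%:R.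

Lemma successor_mean_point (f : V -> R) v a :
  (forall u, u != a -> f u = 0) -> successor_mean f v = p v a * f a.
Proof.
move=> f0; rewrite /successor_mean pE mulrAC; congr (_ / _).
rewrite (bigID (fun i => tnth (succ v) i == a))/= [X in _ + X]big1 ?addr0; last first.
  by move=> i; exact: f0.
under eq_bigr => i /eqP -> do [].
by rewrite sumr_const mulr_natl.
Qed.

Lemma esum_transition (f : V -> R) v : (forall u, 0 <= f u) ->
  (\esum_(u in [set: V]) (p v u * f u)%:E = (successor_mean f v)%:E)%E.
Proof.
move=> f0.
(* The mass that [p v u] puts on [u] is split by successor index: for fixed [i] the function
   [a ^~ i] lives on a single vertex, so exchanging the sums leaves one term per [i]. *)
pose a u (i : 'I_(d v)) : \bar R :=
  if u \in [set tnth (succ v) i] then (f u / (d v)%:R)%:E else 0%E.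
transitivity (\esum_(u in [set: V]) (\sum_(i < d v) a u i))%E.
  apply: eq_esum => u _; rewrite -(@big_mkcond _ _ _ _ _ _ (fun=> (f u / (d v)%:R)%:E)).
  rewrite sumEFin sumr_const pE -mulrA mulrC mulr_natr [_^-1 * _]mulrC.
  congr (_ *+ _)%:E; apply: eq_card => i.
  by rewrite !inE eq_sym; apply/eqP/idP => [->|/set_mem//]; exact/mem_set.
rewrite esum_sum; last by move=> u i _ _; rewrite /a; case: ifP => //; rewrite lee_fin divr_ge0.
rewrite /successor_mean mulr_suml -sumEFin; apply: eq_bigr => i _.
by rewrite -esum_mkcond esum_set1// lee_fin divr_ge0.
Qed.

End SuccessorMean.

(** * Measure-theoretic preliminaries *)

Lemma prob_capT1 d0 (T : measurableType d0) (R : realType)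
    (P : probability T R) (A E : set T) :
  measurable A -> measurable E -> P E = 1%E -> P (A `&` E) = P A.
Proof.
move=> mA mE PE.
have PE0 : P (~` E) = 0%E by rewrite probability_setC// PE subee.
have mAE : measurable (A `&` ~` E) by apply: measurableI => //; exact: measurableC.
rewrite -[in RHS](setIT A) -(setUv E) setIUr measureU0//.
- exact: measurableI.
- apply/eqP; rewrite eq_le measure_ge0 andbT -PE0 le_measure ?inE//.
  exact: measurableC.
Qed.

Lemma measure_fibers d0 (T : measurableType d0) (R : realType)
    (mu : {measure set T -> \bar R}) (A : set T) (Y : T -> nat) :
  (forall n, measurable (A `&` Y @^-1` [set n])) ->
  (mu A = \sum_(n <oo) mu (A `&` Y @^-1` [set n]))%E.
Proof.
move=> mAY; rewrite {1}(_ : A = \bigcup_(n in setT) (A `&` Y @^-1` [set n])); last first.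
  by apply/seteqP; split=> [w Aw|w [n _ []]//]; exists (Y w).
rewrite measure_bigcup//; last first.
  by apply/trivIsetP => i j _ _ ij; apply/seteqP; split=> // w [[_ /= iw] [_ /= jw]];
     move: ij; rewrite -iw -jw eqxx.
by apply: eq_eseriesl => n; rewrite in_setT.
Qed.

(** * Events on trajectories *)

Section PathEvents.
Context (V : countType).
Implicit Types (A : set (nat -> V)) (f g : nat -> V).

Definition shift f : nat -> V := fun k => f k.+1.

(** Stands for membership in the sigma-algebra of the coordinates 0 to [n]. *)
Definition determined_upto n A :=
  forall f g, (forall k, (k <= n)%N -> f k = g k) -> A f -> A g.

(** Since [V] is countable, initial segments can be numbered; the fibres of this code split any
    event into countably many pieces. *)
Definition initial_code n f : nat := pickle (mkseq f n.+1).

Lemma initial_code_inj n f g :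
  initial_code n f = initial_code n g -> forall k, (k <= n)%N -> f k = g k.
Proof.
move=> /(pcan_inj pickleK) fg k kn.
by have := congr1 (nth (f 0%N) ^~ k) fg; rewrite !nth_mkseq.
Qed.

Lemma eq_initial_code n f g :
  (forall k, (k <= n)%N -> f k = g k) -> initial_code n f = initial_code n g.
Proof.
by move=> fg; congr pickle; apply/eq_in_map => k; rewrite mem_iota => /fg.
Qed.

(** A fibre of the code is an atom for the first coordinates, so [A] either misses it or contains
    it. This reduces events to cylinders, the only events [mc_step] speaks of. *)
Lemma initial_code_fiber n A m : determined_upto n A ->
  [set f | A f /\ initial_code n f = m] = set0 \/
  exists g, [set f | A f /\ initial_code n f = m] =
            [set f | forall k, (k <= n)%N -> f k = g k].
Proof.
move=> dA; have [[g [Ag gm]]|nA] := pselect (exists g, A g /\ initial_code n g = m).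
  right; exists g; apply/seteqP; split=> f /=.
    by rewrite -gm => -[_ /initial_code_inj].
  move=> fg; split; first by apply: dA Ag => k /fg.
  by rewrite (eq_initial_code fg).
left; apply/seteqP; split=> // f fA; apply: nA; exists f; exact: fA.
Qed.

(** The time [k] need not be the first visit to [b]: any visit not preceded by [c] witnesses that
    [b] is hit first. *)
Definition hits b c n f := exists k, [/\ (k <= n)%N, f k = b &
  forall j, (j <= k)%N -> f j <> c].

Definition hits_before b c f := exists k, f k = b /\
  forall j, (j <= k)%N -> f j <> c.

Lemma determined_hits b c n : determined_upto n (hits b c n).
Proof.
move=> f g fg [k [kn fk fj]]; exists k; split=> //; first by rewrite -fg.
by move=> j jk; rewrite -fg ?(leq_trans jk)//; exact: fj.
Qed.

Lemma determined_shift n A : determined_upto n A -> determined_upto n.+1 (A \o shift).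
Proof. by move=> dA f g fg; apply: dA => k kn; exact: fg. Qed.

Lemma hits_before_bigcup b c : hits_before b c = \bigcup_n hits b c n.
Proof.
apply/seteqP; split=> [f [k [fk fj]]|f [n _ [k [_ fk fj]]]]; last by exists k.
by exists k => //; exists k.
Qed.

Lemma hits_nondecreasing b c m n : (m <= n)%N -> hits b c m `<=` hits b c n.
Proof. by move=> mn f [k [km fk fj]]; exists k; split=> //; exact: leq_trans mn. Qed.

Lemma hits_target b c n f : b != c -> f 0%N = b -> hits b c n f.
Proof.
move=> bc f0; exists 0%N; split=> // j; rewrite leqn0 => /eqP ->.
by rewrite f0; apply/eqP.
Qed.

Lemma hits_avoid b c n f : f 0%N = c -> ~ hits b c n f.
Proof. by move=> f0 [k [_ _ /(_ 0%N)]]; exact. Qed.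

Lemma hits_shift b c n f : f 0%N != b -> f 0%N != c ->
  hits b c n.+1 f <-> hits b c n (shift f).
Proof.
move=> /eqP f0b /eqP f0c; split=> [[[|k] [kn fk fj]]|[k [kn fk fj]]] //.
  by exists k; split=> // j jk; exact: fj.
by exists k.+1; split=> // -[//|j] jk; exact: fj.
Qed.

(** Look at the first visit to [b]: either [c] occurs before it, or it does not. *)
Lemma return_hits b c f : b != c -> (exists k, shift f k = b) ->
  hits_before b c (shift f) \/ hits_before c b (shift f).
Proof.
move=> /eqP bc ex; have {}ex : exists k, shift f k == b.
  by have [k /eqP fk] := ex; exists k.
have [k /eqP fk kmin] := ex_minnP ex.
have [[j [jk fj]]|nc] := pselect (exists j, (j <= k)%N /\ shift f j = c).
  right; exists j; split=> // i ij fi; have := kmin i; rewrite fi eqxx => /(_ isT) ki.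
  have ijk : i = j by apply/eqP; rewrite eqn_leq ij (leq_trans jk ki).
  by apply: bc; rewrite -fi ijk.
by left; exists k; split=> // j jk fj; apply: nc; exists j.
Qed.

Lemma hits_before_excl b c f : hits_before b c f -> ~ hits_before c b f.
Proof.
move=> [k [fk fj]] [l [fl fi]].
by have [kl|/ltnW lk] := leqP k l; [exact: fi fk|exact: fj fl].
Qed.

End PathEvents.

(** Replaces infima in the extended reals by a condition on the trajectory. The two starting times
    are independent because the escape probability compares [T_c] with [T_b^+]. *)
Lemma hitting_from_ltP (R : realType) (V : countType) (Omega : Type)
    (s s' : nat) (X : nat -> Omega -> V) (b c : V) (w : Omega) :
  (hitting_from R s X b w < hitting_from R s' X c w)%E <->
  exists k, [/\ (s <= k)%N, X k w = b &
    forall j, (s' <= j)%N -> (j <= k)%N -> X j w <> c].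
Proof.
split=> [/ereal_inf_lt[_ [k [sk Xk] <-] kc]|[k [sk Xk Xj]]].
  exists k; split=> // j sj jk Xj; move: kc; apply/negP; rewrite -leNgt.
  by apply: ge_ereal_inf; exists (j%:R)%:E; [exists j|rewrite lee_fin ler_nat].
apply: (@le_lt_trans _ _ (k%:R)%:E).
  by apply: ge_ereal_inf; exists (k%:R)%:E => //; exists k.
(* Every admissible visit to [c] comes at time [k.+1] or later; this integer gap keeps the
   inequality strict through the infimum. *)
apply: (@lt_le_trans _ _ (k.+1%:R)%:E); first by rewrite lte_fin ltr_nat.
apply: le_ereal_inf_tmp => _ [j [sj Xjw] <-]; rewrite lee_fin ler_nat ltnNge.
by apply/negP => /(Xj _ sj).
Qed.

(** * First-step analysis of the chain *)

Section FirstStep.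
Context (R : realType) (V : countType) (p : V -> V -> R)
  (d0 : measure_display) (Omega : measurableType d0)
  (P : V -> probability Omega R) (X : nat -> Omega -> V).
Hypothesis hX : markov_chain p P X.
Implicit Types (A : set (nat -> V)).

Definition path_event A : set Omega := [set w | A (X^~ w)].

Lemma measurable_cylinder n (g : nat -> V) :
  measurable (path_event [set f | forall k, (k <= n)%N -> f k = g k]).
Proof.
rewrite [X in measurable X](_ : _ =
    \bigcap_(k in [set k | (k <= n)%N]) X k @^-1` [set g k]); last first.
  by apply/seteqP; split.
by apply: bigcap_measurable => [|k _]; [exists 0%N|exact: mc_measurable hX _ _].
Qed.

Lemma measurable_fiber n A m : determined_upto n A ->
  measurable (path_event [set f | A f /\ initial_code n f = m]).
Proof.
by move=> /(@initial_code_fiber _ _ _ m)[->|[g ->]];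
  [exact: measurable0|exact: measurable_cylinder].
Qed.

Lemma measurable_path_event n A : determined_upto n A ->
  measurable (path_event A).
Proof.
move=> dA; rewrite [X in measurable X](_ : _ =
    \bigcup_m path_event [set f | A f /\ initial_code n f = m]).
  by apply: bigcupT_measurable => m; exact: measurable_fiber.
by apply/seteqP; split=> [w Aw|w [m _ []]//]; exists (initial_code n (X^~ w)).
Qed.

(** The start [X_0 = v] is almost sure under [P v], so only trajectories from [v] matter. *)
Lemma eq_prob_start v A B :
  measurable (path_event A) -> measurable (path_event B) ->
  (forall f, f 0%N = v -> A f <-> B f) -> P v (path_event A) = P v (path_event B).
Proof.
move=> mA mB AB; have mS : measurable [set w | X 0%N w = v].
  exact: mc_measurable hX 0%N [set v].
rewrite -(prob_capT1 mA mS) ?(mc_start hX)// -[RHS](prob_capT1 mB mS) ?(mc_start hX)//.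
by congr (P v _); apply/seteqP; split=> w [/AB Aw Xw]; split=> //; exact: Aw.
Qed.

(** The Markov property at time 1. As [mc_step] extends a cylinder at its last coordinate, splitting
    off the first one takes an induction on the length. *)
Lemma prob_cylinder_step v n (g : nat -> V) :
  P v (path_event ([set f | forall k, (k <= n)%N -> f k = g k] \o @shift V)) =
  ((p v (g 0%N))%:E *
   P (g 0%N) (path_event [set f | forall k, (k <= n)%N -> f k = g k]))%E.
Proof.
(* Prefixing [g] with [v] turns the shifted cylinder into an ordinary one, one step longer. *)
pose g' k := if k is k'.+1 then g k' else v.
have shiftE m : P v (path_event
    ([set f | forall k, (k <= m)%N -> f k = g k] \o @shift V)) =
    P v (path_event [set f | forall k, (k <= m.+1)%N -> f k = g' k]).
  apply: eq_prob_start; [|exact: measurable_cylinder|].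
    apply: (@measurable_path_event m.+1); apply: determined_shift.
    by move=> f f' ff' fg k km; rewrite -ff'//; exact: fg.
  by move=> f f0; split=> [fg [|k]//|fg k]; [exact: fg|exact: fg k.+1].
have startE u (h : nat -> V) : h 0%N = u ->
    P u (path_event [set f | forall k, (k <= 0)%N -> f k = h k]) = 1%E.
  move=> h0; rewrite -(mc_start hX u); congr (P u _).
  apply/seteqP; split=> w /=; first by rewrite -h0; exact.
  by move=> X0 k; rewrite leqn0 => /eqP ->; rewrite X0.
elim: n => [|n IHn].
  by rewrite shiftE [LHS](mc_step hX) [X in (X * _)%E]startE// startE// mul1e mule1.
by rewrite shiftE [LHS](mc_step hX) -[X in (X * _)%E]shiftE IHn -muleA -(mc_step hX).
Qed.

Context (d : V -> nat) (succ : forall u, (d u).-tuple V).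
Hypothesis pE : forall u v, p u v =
  #|[pred i : 'I_(d u) | tnth (succ u) i == v]|%:R / (d u)%:R.

Lemma EFin_prob v A : measurable (path_event A) ->
  (fine (P v (path_event A)))%:E = P v (path_event A).
Proof. by move=> mA; rewrite fineK// fin_num_measure. Qed.

(** Sum [prob_cylinder_step] over the fibres of the code; the countable sum commutes with the finite
    average over successors. *)
Lemma first_step v n A : determined_upto n A ->
  P v (path_event (A \o @shift V)) =
  (successor_mean succ (fun u => fine (P u (path_event A))) v)%:E.
Proof.
move=> dA; have mA : measurable (path_event A) by exact: measurable_path_event dA.
pose fib m := [set f | A f /\ initial_code n f = m].
have mfib m : measurable (path_event (fib m)) by exact: measurable_fiber.
have dfib m : determined_upto n (fib m).
  move=> f g fg [Af <-]; split; first exact: dA fg Af.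
  by apply: eq_initial_code => k kn; rewrite fg.
have meanE B : measurable (path_event B) ->
    (successor_mean succ (fun u => fine (P u (path_event B))) v)%:E =
    ((d v)%:R^-1%:E * \sum_(i < d v) P (tnth (succ v) i) (path_event B))%E.
  move=> mB; rewrite /successor_mean mulrC EFinM -sumEFin; congr (_ * _)%E.
  by apply: eq_bigr => i _; rewrite EFin_prob.
have stepE m : P v (path_event (fib m \o @shift V)) =
    ((d v)%:R^-1%:E * \sum_(i < d v) P (tnth (succ v) i) (path_event (fib m)))%E.
  rewrite -meanE//; have [fib0|[g fibE]] := initial_code_fiber m dA.
    rewrite /fib fib0 /successor_mean big1 ?mul0r => [|i _]; last by rewrite measure0.
    exact: measure0.
  (* The cylinder has probability zero from any vertex other than [g 0], so the average reduces to
     one transition probability. *)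
  rewrite /fib fibE (@successor_mean_point _ _ _ _ p pE _ v (g 0%N)); last first.
    move=> u ug; rewrite (@eq_prob_start _ _ set0).
    - by rewrite measure0.
    - exact: measurable_cylinder.
    - exact: measurable0.
    - move=> f fu; split=> // /(_ 0%N isT); rewrite fu => ug'.
      by move: ug; rewrite ug' eqxx.
  by rewrite prob_cylinder_step EFinM EFin_prob//; exact: measurable_cylinder.
rewrite meanE// (@measure_fibers _ _ _ _ _ (fun w => initial_code n (shift (X^~ w)))).
  transitivity (\sum_(m <oo) ((d v)%:R^-1%:E *
      \sum_(i < d v) P (tnth (succ v) i) (path_event (fib m))))%E.
    by apply: eq_eseriesr => m _; rewrite -stepE.
  rewrite nneseriesZl => [|m _]; last exact: sume_ge0.
  congr (_ * _)%E; rewrite nneseries_sum//; apply: eq_bigr => i _.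
  rewrite [RHS](@measure_fibers _ _ _ _ _ (fun w => initial_code n (X^~ w)))//.
move=> m; exact: measurable_path_event (determined_shift (dfib m)).
Qed.

End FirstStep.

(** * Hitting probabilities as limits of time-truncated ones *)

Section HittingProbabilities.
Context (R : realType) (V : countType) (p : V -> V -> R)
  (d0 : measure_display) (Omega : measurableType d0)
  (P : V -> probability Omega R) (X : nat -> Omega -> V).
Hypothesis hX : markov_chain p P X.
Context (d : V -> nat) (succ : forall u, (d u).-tuple V).
Hypothesis pE : forall u v, p u v =
  #|[pred i : 'I_(d u) | tnth (succ u) i == v]|%:R / (d u)%:R.

(** The truncation makes the event depend on finitely many coordinates, as [first_step] requires. *)
Definition hit_by (n : nat) (b c v : V) : R :=
  fine (P v (path_event X (hits b c n))).

Notation h := (hit_before P X).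

Lemma measurable_hits b c n : measurable (path_event X (hits b c n)).
Proof. exact: (measurable_path_event hX (@determined_hits V b c n)). Qed.

Lemma measurable_shifted_hits b c n :
  measurable (path_event X (hits b c n \o @shift V)).
Proof.
exact: (measurable_path_event hX (determined_shift (@determined_hits V b c n))).
Qed.

Lemma shifted_hits_before_bigcup b c :
  path_event X (hits_before b c \o @shift V) =
  \bigcup_n path_event X (hits b c n \o @shift V).
Proof. by rewrite hits_before_bigcup. Qed.

Lemma measurable_hits_before b c : measurable (path_event X (hits_before b c)).
Proof.
rewrite hits_before_bigcup.
by apply: (@bigcupT_measurable _ _ (fun n => path_event X (hits b c n))) => n;
  exact: measurable_hits.
Qed.

Lemma measurable_shifted_hits_before b c :
  measurable (path_event X (hits_before b c \o @shift V)).
Proof.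
rewrite shifted_hits_before_bigcup.
by apply: bigcupT_measurable => n; exact: measurable_shifted_hits.
Qed.

Lemma hit_beforeE b c v : h b c v = fine (P v (path_event X (hits_before b c))).
Proof.
rewrite /hit_before /hitting_time; congr (fine (P v _)).
apply/seteqP; split=> w /=.
  by move=> /hitting_from_ltP[k [_ Xk Xj]]; exists k; split=> // j; exact: Xj.
by move=> [k [Xk Xj]]; apply/hitting_from_ltP; exists k; split=> // j _; exact: Xj.
Qed.

Lemma fine_prob_ge0 v A : 0 <= fine (P v A).
Proof. exact: fine_ge0. Qed.

Lemma fine_prob_le1 v A : measurable A -> fine (P v A) <= 1.
Proof.
by move=> mA; rewrite -lee_fin fineK ?fin_num_measure// probability_le1.
Qed.

Lemma hit_before_ge0 b c v : 0 <= h b c v.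
Proof. by rewrite hit_beforeE fine_prob_ge0. Qed.

Lemma hit_before_le1 b c v : h b c v <= 1.
Proof. by rewrite hit_beforeE fine_prob_le1//; exact: measurable_hits_before. Qed.

Lemma hit_by_ge0 n b c v : 0 <= hit_by n b c v.
Proof. exact: fine_prob_ge0. Qed.

Lemma hit_by_le1 n b c v : hit_by n b c v <= 1.
Proof. by rewrite fine_prob_le1//; exact: measurable_hits. Qed.

Lemma hit_by_nondecreasing b c v m n : (m <= n)%N -> hit_by m b c v <= hit_by n b c v.
Proof.
move=> mn; apply: fine_le; rewrite ?fin_num_measure//; try exact: measurable_hits.
apply: le_measure; rewrite ?inE; try exact: measurable_hits.
by move=> w; exact: hits_nondecreasing.
Qed.

Lemma cvg_hit_by b c v : hit_by n b c v @[n --> \oo] --> h b c v.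
Proof.
rewrite hit_beforeE; apply: fine_cvg; rewrite fineK; last first.
  by rewrite fin_num_measure//; exact: measurable_hits_before.
rewrite hits_before_bigcup.
apply: (@nondecreasing_cvg_mu _ _ _ (P v) (fun n => path_event X (hits b c n))).
- by move=> n; exact: measurable_hits.
- by apply: bigcupT_measurable => n; exact: measurable_hits.
- by move=> m n mn; apply/subsetPset => w; exact: hits_nondecreasing.
Qed.

Lemma mean_hit_by n b c v :
  P v (path_event X (hits b c n \o @shift V)) =
  (successor_mean succ (hit_by n b c) v)%:E.
Proof. by rewrite (first_step hX pE v (@determined_hits V b c n)). Qed.

(** The untruncated event depends on the whole trajectory, so [first_step] is carried over by
    monotone continuity: both sides are limits of the same sequence. *)
Lemma mean_hit_before b c v :
  P v (path_event X (hits_before b c \o @shift V)) =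
  (successor_mean succ (h b c) v)%:E.
Proof.
have mean_cvg : (successor_mean succ (hit_by n b c) v)%:E @[n --> \oo] -->
    (successor_mean succ (h b c) v)%:E.
  apply: cvg_EFin; first exact: nearW.
  by apply: cvg_successor_mean => u; exact: cvg_hit_by.
apply: cvg_unique mean_cvg => //=.
under eq_cvg => n do rewrite -mean_hit_by.
rewrite shifted_hits_before_bigcup; apply: nondecreasing_cvg_mu.
- by move=> n; exact: measurable_shifted_hits.
- by apply: bigcupT_measurable => n; exact: measurable_shifted_hits.
- by move=> m n mn; apply/subsetPset => w; exact: hits_nondecreasing.
Qed.

Lemma hit_by_target n b c : b != c -> hit_by n b c b = 1.
Proof.
move=> bc; rewrite /hit_by (@eq_prob_start _ _ _ _ _ _ _ hX _ _ setT).
- by rewrite [path_event X _](_ : _ = setT) ?probability_setT.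
- exact: measurable_hits.
- exact: measurableT.
- by move=> f f0; split=> // _; exact: hits_target.
Qed.

Lemma hit_by_avoid n b c : hit_by n b c c = 0.
Proof.
rewrite /hit_by (@eq_prob_start _ _ _ _ _ _ _ hX _ _ set0).
- by rewrite measure0.
- exact: measurable_hits.
- exact: measurable0.
- by move=> f f0; split=> // /hits_avoid; exact.
Qed.

Lemma hit_by0 b c v : v != b -> hit_by 0 b c v = 0.
Proof.
move=> vb; rewrite /hit_by (@eq_prob_start _ _ _ _ _ _ _ hX _ _ set0).
- by rewrite measure0.
- exact: measurable_hits.
- exact: measurable0.
- move=> f f0; split=> // -[k []]; rewrite leqn0 => /eqP ->.
  by rewrite f0 => vb'; move: vb; rewrite vb' eqxx.
Qed.

Lemma hit_by_step n b c v : v != b -> v != c ->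
  hit_by n.+1 b c v = successor_mean succ (hit_by n b c) v.
Proof.
move=> vb vc; rewrite /hit_by (@eq_prob_start _ _ _ _ _ _ _ hX _ _
  (hits b c n \o @shift V)).
- by rewrite mean_hit_by.
- exact: measurable_hits.
- exact: measurable_shifted_hits.
- by move=> f f0; apply: hits_shift; rewrite f0.
Qed.

Lemma hit_before_target b c : b != c -> h b c b = 1.
Proof.
move=> bc; apply: (@cvg_unique _ _ (hit_by n b c b @[n --> \oo])) => //=.
  exact: cvg_hit_by.
under eq_cvg => n do rewrite hit_by_target//.
exact: cvg_cst.
Qed.

Lemma hit_before_avoid b c : h b c c = 0.
Proof.
apply: (@cvg_unique _ _ (hit_by n b c c @[n --> \oo])) => //=.
  exact: cvg_hit_by.
under eq_cvg => n do rewrite hit_by_avoid.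
exact: cvg_cst.
Qed.

Lemma hit_before_harmonic b c v : v != b -> v != c ->
  h b c v = successor_mean succ (h b c) v.
Proof.
move=> vb vc; apply: (@cvg_unique _ _ (hit_by n.+1 b c v @[n --> \oo])) => //=.
  by rewrite (cvg_shiftS (fun n => hit_by n b c v)); exact: cvg_hit_by.
under eq_cvg => n do rewrite hit_by_step//.
by apply: cvg_successor_mean => u; exact: cvg_hit_by.
Qed.

(** Time 0 is spent at [b], which is neither a visit to [c] nor a return; seen from time 1, escaping
    is hitting [c] before [b]. *)
Lemma escape_probabilityE b c : b != c ->
  escape_probability P X b c = successor_mean succ (h c b) b.
Proof.
move=> bc; rewrite -[RHS]/(fine (_%:E)) -mean_hit_before /escape_probability.
congr fine; pose A : set (nat -> V) := [set f | exists k, f k = c /\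
  forall j, (1 <= j)%N -> (j <= k)%N -> f j <> b].
have AE f : f 0%N = b -> A f <-> (hits_before c b \o @shift V) f.
  move=> f0; split=> [[[|k] [fk fj]]|[k [fk fj]]].
  - by move: bc; rewrite -f0 fk eqxx.
  - by exists k; split=> // j jk; exact: fj.
  - by exists k.+1; split=> // -[//|j] _ jk; exact: fj.
rewrite (_ : [set w | _] = path_event X A); last first.
  apply/seteqP; split=> w /=.
    by move=> /hitting_from_ltP[k [_ Xk Xj]]; exists k.
  by move=> [k [Xk Xj]]; apply/hitting_from_ltP; exists k.
apply: (eq_prob_start hX) => //; last exact: measurable_shifted_hits_before.
have -> : A = \bigcup_k [set f | f k = c /\
    forall j, (1 <= j)%N -> (j <= k)%N -> f j <> b].
  by apply/seteqP; split=> [f [k Ak]|f [k _ Ak]]; exists k.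
apply: (@bigcupT_measurable _ _ (fun k => path_event X [set f | f k = c /\
    forall j, (1 <= j)%N -> (j <= k)%N -> f j <> b])) => k.
apply: (@measurable_path_event _ _ _ _ _ _ _ hX k) => f g fg [fk fj].
by split=> [|j j1 jk]; rewrite -fg//; exact: fj.
Qed.

(** The two events are disjoint, and by [return_hits] they cover the almost sure event of returning
    to [b]. *)
Lemma mean_hit_before_return b c : recurrent_chain P X -> b != c ->
  successor_mean succ (h b c) b + successor_mean succ (h c b) b = 1.
Proof.
move=> hrec bc; apply: EFin_inj; rewrite EFinD -!mean_hit_before.
rewrite -measureU; [|exact: measurable_shifted_hits_before..|]; last first.
  by apply/seteqP; split=> // w [/hits_before_excl].
have mU : measurable (path_event X (hits_before b c \o @shift V) `|`
    path_event X (hits_before c b \o @shift V)).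
  by apply: measurableU; exact: measurable_shifted_hits_before.
apply/eqP; rewrite eq_le probability_le1//= -(hrec b) le_measure ?inE//.
  rewrite [X in measurable X](_ : _ = \bigcup_k X k.+1 @^-1` [set b]).
    by apply: bigcupT_measurable => k; exact: mc_measurable hX _ _.
  apply/seteqP; split=> w /=.
    by move=> /ereal_inf_lt[_ [[|k] [k1 Xk] _] _] //; exists k.
  move=> [k _ Xk]; apply: (@le_lt_trans _ _ (k.+1%:R)%:E); last exact: ltry.
  by apply: ge_ereal_inf; exists (k.+1%:R)%:E => //; exists k.+1.
move=> w /= /ereal_inf_lt[_ [[|k] [k1 Xk] _] _] //.
by apply: return_hits => //; exists k.
Qed.

End HittingProbabilities.

(** * Unordered sums of nonnegative extended reals *)

Lemma esumZl (R : realType) (T : choiceType) (S : set T) (a : T -> \bar R) (x : R) :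
  0 <= x -> (forall i, 0 <= a i)%E ->
  (\esum_(i in S) (x%:E * a i) = x%:E * \esum_(i in S) a i)%E.
Proof.
move=> x0 a0.
(* One inequality is enough: applied with the factor [x^-1] it yields the converse when [x] is
   nonzero. *)
have le_esumZ y (f : T -> \bar R) : 0 <= y -> (forall i, 0 <= f i)%E ->
    (\esum_(i in S) (y%:E * f i) <= y%:E * \esum_(i in S) f i)%E.
  move=> y0 f0; apply: ge_ereal_sup => _ [F FS <-].
  rewrite -ge0_mule_fsumr// lee_wpmul2l ?lee_fin//.
  by apply: ereal_sup_ubound; exists F.
have [->|xn0] := eqVneq x 0.
  by rewrite mul0e esum1// => i _; rewrite mul0e.
apply/eqP; rewrite eq_le le_esumZ//=.
have xa0 i : (0 <= x%:E * a i)%E by rewrite mule_ge0 ?lee_fin.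
rewrite [X in (x%:E * X)%E](_ : _ = \esum_(i in S) (x^-1%:E * (x%:E * a i)))%E; last first.
  by apply: eq_esum => i _; rewrite muleA -EFinM mulVf// mul1e.
apply: le_trans (lee_wpmul2l _ (le_esumZ x^-1 _ _ xa0)) _; rewrite ?lee_fin ?invr_ge0//.
by rewrite muleA -EFinM divff// mul1e.
Qed.

Lemma exchange_esum (R : realType) (S T : choiceType) (a : S -> T -> \bar R) :
  (forall i j, 0 <= a i j)%E ->
  (\esum_(i in [set: S]) \esum_(j in [set: T]) a i j =
   \esum_(j in [set: T]) \esum_(i in [set: S]) a i j)%E.
Proof.
move=> a0; rewrite !esum_esum//.
rewrite [RHS](@reindex_esum _ _ _ ([set: S] `*`` (fun=> [set: T])) _ (fun x => (x.2, x.1)))//.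
by split=> [[]//|[i j] [i' j'] _ _ [-> ->]|[j i] _]//; exists (i, j).
Qed.

(** * Stationarity and escape probabilities *)

Section Escape.
Context (R : realType) (V : countType) (p : V -> V -> R)
  (d0 : measure_display) (Omega : measurableType d0)
  (P : V -> probability Omega R) (X : nat -> Omega -> V).
Hypothesis hX : markov_chain p P X.
Context (d : V -> nat) (succ : forall u, (d u).-tuple V).
Hypothesis pE : forall u v, p u v =
  #|[pred i : 'I_(d u) | tnth (succ u) i == v]|%:R / (d u)%:R.
Hypothesis d_gt0 : forall u, (0 < d u)%N.
Context (pi : V -> R).
Hypothesis hpi : stationary_vector p pi.

Notation h := (hit_before P X).
Notation mean := (successor_mean succ).

(** Tonelli's theorem followed by stationarity; both sides may be infinite. *)
Lemma stationary_mean (f : V -> R) : (forall v, 0 <= f v) ->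
  (\esum_(v in [set: V]) (pi v * mean f v)%:E =
   \esum_(v in [set: V]) (pi v * f v)%:E)%E.
Proof.
move=> f0; have [pi_gt0 piE] := hpi.
have pi0 v := ltW (pi_gt0 v).
have p0 u v : 0 <= p u v by rewrite pE divr_ge0.
transitivity (\esum_(v in [set: V]) \esum_(u in [set: V]) (pi v * (p v u * f u))%:E)%E.
  apply: eq_esum => v _; rewrite EFinM -(esum_transition pE)// -esumZl// => u.
  by rewrite lee_fin mulr_ge0.
rewrite exchange_esum => [|v u]; last by rewrite lee_fin !mulr_ge0.
apply: eq_esum => u _.
rewrite [(pi u * _)%R]mulrC EFinM -piE -esumZl// => [|v]; last by rewrite lee_fin mulr_ge0.
by apply: eq_esum => v _; rewrite -EFinM; congr EFin; rewrite mulrA mulrC.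
Qed.

Lemma esum_point (f : V -> R) a : (forall v, 0 <= f v) -> (forall v, v != a -> f v = 0) ->
  (\esum_(v in [set: V]) (f v)%:E = (f a)%:E)%E.
Proof.
move=> f0 fa; transitivity (\esum_(v in [set a]) (f v)%:E)%E; last by rewrite esum_set1 ?lee_fin.
rewrite [RHS]esum_mkcond.
apply: eq_esum => v _; case: ifPn => // /negP va.
by rewrite fa//; apply/eqP => /= va'; apply: va; exact/mem_set.
Qed.

(* [pi] may have infinite total mass; truncating in time is what makes the
   cancellation in [stationary_escape_le] legitimate. *)
Lemma summable_hit_by n b c : b != c ->
  (\esum_(v in [set: V]) (pi v * hit_by P X n b c v)%:E < +oo)%E.
Proof.
move=> bc; have [pi_gt0 _] := hpi; have pi0 v := ltW (pi_gt0 v).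
have hit0 m u : 0 <= hit_by P X m b c u by exact: hit_by_ge0.
elim: n => [|n IHn].
  rewrite (@esum_point _ b) ?ltry// => [v|v vb]; first by rewrite mulr_ge0.
  by rewrite (hit_by0 hX)// mulr0.
(* Only at [b] can [hit_by n.+1] exceed the average of [hit_by n], and there it equals 1; [g] pays
   for this excess. *)
pose g v := if v == b then pi b else 0.
have g0 v : 0 <= g v by rewrite /g; case: ifP.
apply: (@le_lt_trans _ _ (\esum_(v in [set: V])
    ((g v)%:E + (pi v * mean (hit_by P X n b c) v)%:E))%E).
  apply: le_esum => v _; rewrite -EFinD lee_fin /g.
  have mean0 := @successor_mean_ge0 _ _ _ succ (hit_by P X n b c) v (hit0 n).
  have [->|vb] := eqVneq v b.
    by rewrite (hit_by_target hX)// mulr1 lerDl mulr_ge0// successor_mean_ge0.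
  rewrite add0r ler_wpM2l//; have [->|vc] := eqVneq v c.
    by rewrite (hit_by_avoid hX) successor_mean_ge0.
  by rewrite (hit_by_step hX pE).
rewrite esumD; last 2 first.
- by move=> v _; rewrite lee_fin.
- by move=> v _; rewrite lee_fin mulr_ge0// successor_mean_ge0.
rewrite stationary_mean// lte_add_pinfty// (@esum_point _ b) ?ltry//.
by move=> v /negPf; rewrite /g => ->.
Qed.

Lemma stationary_escape_le b c : b != c ->
  pi c * mean (h b c) c <= pi b * (1 - mean (h b c) b).
Proof.
move=> bc; have [pi_gt0 _] := hpi; have pi0 v := ltW (pi_gt0 v).
have mean_cvg v : mean (hit_by P X n b c) v @[n --> \oo] --> mean (h b c) v.
  by apply: cvg_successor_mean => u; exact: (cvg_hit_by hX).
apply: (@ler_cvg_to _ \oo _ _ (fun n => pi c * mean (hit_by P X n b c) c)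
  (fun n => pi b * (1 - mean (hit_by P X n b c) b))).
- by apply: cvgM; [exact: cvg_cst|exact: mean_cvg].
- apply: cvgM; first exact: cvg_cst.
  by apply: cvgB; [exact: cvg_cst|exact: mean_cvg].
apply: nearW => n.
set H := hit_by P X n b c.
have H0 u : 0 <= H u by exact: hit_by_ge0.
have H1 u : H u <= 1 by exact: (hit_by_le1 hX).
have meanH0 v : 0 <= mean H v by exact: successor_mean_ge0.
have meanH1 v : mean H v <= 1 by exact: successor_mean_le1.
(* [x] and [y] are the corrections at [b] and [c] that give equality there; elsewhere the comparison
   is monotonicity of [hit_by] in time. *)
pose x v := if v == b then pi b * (1 - mean H b) else 0.
pose y v := if v == c then pi c * mean H c else 0.
have x0 v : 0 <= x v by rewrite /x; case: ifP => // _; rewrite mulr_ge0 ?subr_ge0.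
have y0 v : 0 <= y v by rewrite /y; case: ifP => // _; rewrite mulr_ge0.
have xy v : pi v * H v + y v <= pi v * mean H v + x v.
  rewrite /x /y; have [vb|vb] := eqVneq v b.
    rewrite vb (negPf bc) {1}/H (hit_by_target hX)//; lra.
  have [vc|vc] := eqVneq v c; first by rewrite vc {1}/H (hit_by_avoid hX); lra.
  rewrite !addr0 ler_wpM2l// -(hit_by_step hX pE)//.
  exact: (hit_by_nondecreasing hX).
have : (\esum_(v in [set: V]) ((pi v * H v)%:E + (y v)%:E) <=
    \esum_(v in [set: V]) ((pi v * mean H v)%:E + (x v)%:E))%E.
  by apply: le_esum => v _; rewrite -!EFinD lee_fin.
have pimean0 v : 0 <= pi v * mean H v by rewrite mulr_ge0.
rewrite !esumD; try by move=> v _; rewrite lee_fin// mulr_ge0.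
(* Both sides now contain the same sum of [pi v * H v], which is finite and cancels. *)
rewrite stationary_mean// leeD2lE; last first.
  rewrite ge0_fin_numE ?summable_hit_by//.
  by apply: esum_ge0 => v _; rewrite lee_fin mulr_ge0.
rewrite (@esum_point y c)// => [|v /negPf]; last by rewrite /y => ->.
rewrite (@esum_point x b)// => [|v /negPf]; last by rewrite /x => ->.
by rewrite lee_fin /x /y !eqxx.
Qed.

(* [stationary_escape_le] for [(b, c)] and for [(c, b)] are opposite
   inequalities, because recurrence gives [Ph_bc(b) + Ph_cb(b) = 1]. *)
Lemma stationary_escape b c : recurrent_chain P X -> b != c ->
  pi b * mean (h c b) b = pi c * mean (h b c) c.
Proof.
move=> hrec bc; have cb : c != b by rewrite eq_sym.
have e1 : 1 - mean (h b c) b = mean (h c b) b.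
  by rewrite -(mean_hit_before_return hX pE hrec bc) addrAC subrr add0r.
have e2 : 1 - mean (h c b) c = mean (h b c) c.
  by rewrite -(mean_hit_before_return hX pE hrec cb) addrAC subrr add0r.
apply/eqP; rewrite eq_le -{1}e2 -{2}e1.
by rewrite !stationary_escape_le.
Qed.

(** Were it zero, the zero set of [h c b] would contain [b], avoid [c] and be closed under
    successors (by harmonicity off [b]), so the chain from [b] would never reach [c]. *)
Lemma escape_gt0 b c : irreducible_chain P X -> b != c -> 0 < mean (h c b) b.
Proof.
move=> hirr bc; have h0 := hit_before_ge0 P X c b.
rewrite lt0r successor_mean_ge0// andbT; apply/eqP => e0.
have closed v : h c b v = 0 -> forall i, h c b (tnth (succ v) i) = 0.
  move=> hv0; apply: successor_mean_eq0 => //.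
  have [->//|vb] := eqVneq v b.
  rewrite -(hit_before_harmonic hX pE)//; apply/eqP => vc; move: hv0.
  by rewrite vc (hit_before_target hX) 1?eq_sym// => /eqP; rewrite oner_eq0.
have dcoord n : determined_upto n [set f : nat -> V | f n = c].
  by move=> f g fg /= <-; rewrite fg.
have never n v : h c b v = 0 -> P v [set w | X n w = c] = 0%E.
  elim: n v => [|n IHn] v hv0.
    rewrite -[LHS]/(P v (path_event X [set f | f 0%N = c])).
    rewrite (@eq_prob_start _ _ _ _ _ _ _ hX _ _ set0) ?measure0//.
    - exact: (measurable_path_event hX (dcoord 0%N)).
    - exact: measurable0.
    - move=> f f0; split=> //= fc; move: hv0.
      by rewrite -f0 fc (hit_before_target hX) 1?eq_sym// => /eqP; rewrite oner_eq0.
  rewrite -[LHS]/(P v (path_event X ([set f | f n = c] \o @shift V))).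
  rewrite (first_step hX pE v (dcoord n)) /successor_mean big1 ?mul0r// => i _.
  by rewrite [P _ _](IHn _ (closed _ hv0 i)).
have [n] := hirr b c.
by rewrite never ?ltxx// (hit_before_avoid hX).
Qed.

End Escape.

(** * Rotor weights and the potential of the walk *)

Lemma partial_sum_dist (R : realFieldType) (a : nat -> R) (n q r : nat) :
  (q <= n)%N -> (r <= n)%N -> \sum_(0 <= i < n) a i = 0 ->
  `|\sum_(0 <= i < q) a i - \sum_(0 <= i < r) a i| <=
    2^-1 * \sum_(0 <= i < n) `|a i|.
Proof.
wlog qr : q r / (q <= r)%N => [wh|].
  by have [/wh|/ltnW/wh h qn rn] := leqP q r; [exact|rewrite distrC; exact: h].
move=> qn rn a0.
move: a0; rewrite !(@big_cat_nat _ _ _ r 0 n)//= !(@big_cat_nat _ _ _ q 0 r)//=.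
set A := \sum_(0 <= i < q) a i; set B := \sum_(q <= i < r) a i.
set C := \sum_(r <= i < n) a i => a0.
have nA : `|A| <= \sum_(0 <= i < q) `|a i| by exact: ler_norm_sum.
have nB : `|B| <= \sum_(q <= i < r) `|a i| by exact: ler_norm_sum.
have nC : `|C| <= \sum_(r <= i < n) `|a i| by exact: ler_norm_sum.
(* Since the total vanishes, [B] is minus the sum of the outer blocks, so twice its absolute value
   is at most the full absolute sum. Hence the factor 1/2 in [K3]. *)
have nAC : `|B| <= `|A| + `|C|.
  by rewrite (_ : B = - (A + C)) ?normrN ?ler_normD//; lra.
by rewrite opprD addrA subrr sub0r normrN; lra.
Qed.

Section RotorPotential.
Context (R : realType) (V : countType) (d : V -> nat)
  (succ : forall u, (d u).-tuple V).
Hypothesis d_gt0 : forall u, (0 < d u)%N.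
Context (h : V -> R).
Notation mean := (successor_mean succ).

Definition drift (v : V) : R := mean h v - h v.

(* The term [drift u] makes the increments over one full turn of the rotor at
   [u] sum to zero. *)
Definition rotor_increment (u : V) (i : nat) : R :=
  h u - h (nth u (succ u) i) + drift u.

(** List entry [i] is successor number [i + 1], so position [r] collects the increments of
    successors 1 to [r]. *)
Definition rotor_weight (u : V) (r : nat) : R :=
  \sum_(0 <= i < r) rotor_increment u i.

Lemma sum_nth_successors (f : V -> R) u :
  \sum_(0 <= i < d u) f (nth u (succ u) i) = (d u)%:R * mean f u.
Proof.
rewrite big_mkord -(sum_successors succ d_gt0).
by apply: eq_bigr => i _; rewrite (tnth_nth u).
Qed.

Lemma rotor_weight_full u : rotor_weight u (d u) = 0.
Proof.
rewrite /rotor_weight 2!big_split/= sumrN (sum_nth_successors h).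
rewrite !sumr_const_nat subn0 -[h u *+ _]mulr_natl -[drift u *+ _]mulr_natl /drift; lra.
Qed.

(** The first term leads to the double sum in [K3], the drift term to [d b + d c]. *)
Lemma rotor_weight_dist u q r : (q <= d u)%N -> (r <= d u)%N ->
  `|rotor_weight u q - rotor_weight u r| <= 2^-1 *
    ((d u)%:R * mean (fun v => `|h u - h v|) u + (d u)%:R * `|drift u|).
Proof.
move=> qd rd.
apply: (le_trans (partial_sum_dist qd rd (rotor_weight_full u))).
rewrite ler_pM2l ?invr_gt0// -(sum_nth_successors (fun v => `|h u - h v|)).
rewrite (_ : (d u)%:R * _ = \sum_(0 <= i < d u) `|drift u|); last first.
  by rewrite sumr_const_nat subn0 mulr_natl.
by rewrite -big_split/=; apply: ler_sum => i _; exact: ler_normD.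
Qed.

(** The full turn has weight zero, so the jump from [d u] back to 1 obeys the same rule as an
    ordinary advance. *)
Lemma rotor_weight_step u r : (0 < r <= d u)%N ->
  let r' := if (r < d u)%N then r.+1 else 1%N in
  rotor_weight u r' = rotor_weight u r + rotor_increment u r'.-1.
Proof.
move=> /andP[r0 rd] /=; case: ltnP => dr; first by rewrite /rotor_weight big_nat_recr.
have -> : r = d u by apply/eqP; rewrite eqn_leq rd.
by rewrite rotor_weight_full /rotor_weight big_nat1 add0r.
Qed.

Context (x0 : V) (r0 : V -> nat).
Hypothesis hr0 : rotor_configuration d r0.
Notation x := (rotor_walk succ x0 r0).
Let rotors t := (iter t (rotor_step succ) (x0, r0)).2.

Lemma rotorsS t v : rotors t.+1 v =
  if v == x t then
    (if (rotors t (x t) < d (x t))%N then (rotors t (x t)).+1 else 1%N)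
  else rotors t v.
Proof. by rewrite /rotors /rotor_walk /=; case: (iter t _ _). Qed.

Lemma rotor_walkS t :
  x t.+1 = nth (x t) (succ (x t)) (rotors t.+1 (x t)).-1.
Proof. by rewrite /rotors /rotor_walk /=; case: (iter t _ _). Qed.

Lemma rotors_configuration t : rotor_configuration d (rotors t).
Proof.
elim: t => [|t IHt] v; first exact: hr0.
rewrite rotorsS; have [->|_] := eqVneq v (x t); last exact: IHt.
by case: ifP => // _; exact: d_gt0.
Qed.

(** The rotor at [x t] advances to the successor visited next, so its weight changes by
    [h (x t) - h (x t.+1) + drift (x t)]; the differences of [h] cancel. Unvisited vertices keep
    their weight, so a finite [U] containing the visited ones suffices. *)
Lemma rotor_potential (U : seq V) t : uniq U ->
  (forall s, (s < t)%N -> x s \in U) ->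
  h (x t) + \sum_(u <- U) rotor_weight u (rotors t u) =
  h x0 + \sum_(u <- U) rotor_weight u (r0 u) + \sum_(s < t) drift (x s).
Proof.
move=> uU; elim: t => [|t IHt] xU; first by rewrite big_ord0 addr0.
rewrite big_ord_recr/= addrA -IHt => [|s st]; last by apply: xU; exact: ltnW.
have xtU : x t \in U by exact: xU.
rewrite (bigD1_seq (x t))// [in RHS](bigD1_seq (x t))//=.
rewrite (eq_bigr (fun u => rotor_weight u (rotors t u))); last first.
  by move=> u /negPf ut; rewrite rotorsS ut.
rewrite rotor_walkS rotorsS eqxx rotor_weight_step; last exact: rotors_configuration.
rewrite /rotor_increment; lra.
Qed.

(** The summand 1 bounds the change of [h] along the walk, the rest the change of the weights. *)
Lemma rotor_drift_bound (U : seq V) t : (forall v, 0 <= h v <= 1) -> uniq U ->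
  (forall s, (s < t)%N -> x s \in U) ->
  `|\sum_(s < t) drift (x s)| <= 1 + 2^-1 * \sum_(u <- U)
    ((d u)%:R * mean (fun v => `|h u - h v|) u + (d u)%:R * `|drift u|).
Proof.
move=> h01 uU xU.
have -> : \sum_(s < t) drift (x s) = (h (x t) - h x0) + \sum_(u <- U)
    (rotor_weight u (rotors t u) - rotor_weight u (r0 u)).
  by rewrite [X in _ = _ + X]sumrB; have := rotor_potential uU xU; lra.
apply: le_trans (ler_normD _ _) _; apply: lerD.
  by have := h01 (x t); have := h01 x0; rewrite ler_norml; lra.
rewrite mulr_sumr; apply: le_trans (ler_norm_sum _ _ _) _; apply: ler_sum => u _.
apply: rotor_weight_dist; last by have /andP[] := hr0 u.
by have /andP[] := rotors_configuration t u.
Qed.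

End RotorPotential.

(** * From accumulated drift to visit counts *)

Lemma sum_visits (R : realType) (V : countType) (x : nat -> V) (t : nat)
    (b c : V) (f : V -> R) : b != c ->
  (forall v, v != b -> v != c -> f v = 0) ->
  \sum_(s < t) f (x s) = (visits x t b)%:R * f b + (visits x t c)%:R * f c.
Proof.
move=> bc f0; have visitsE v : (visits x t v)%:R = \sum_(s < t | x s == v) 1 :> R.
  by rewrite sumr_const; congr (_%:R); apply: eq_card.
rewrite !visitsE !mulr_suml (bigID (fun s => x (nat_of_ord s) == b))/=; congr (_ + _).
  by apply: eq_bigr => s /eqP ->; rewrite mul1r.
rewrite (bigID (fun s => x (nat_of_ord s) == c))/= [X in _ + X]big1 ?addr0.
  apply: eq_big => [s|s /andP[_ /eqP ->]]; last by rewrite mul1r.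
  by case: (x s =P c) => [->|_]; rewrite ?andbT ?andbF// eq_sym.
by move=> s /andP[]; exact: f0.
Qed.

Lemma sum_two_points (R : realFieldType) (V : eqType) (U : seq V) (b c : V)
    (f : V -> R) : uniq U -> b != c -> b \in U -> c \in U ->
  (forall v, v != b -> v != c -> f v = 0) -> \sum_(u <- U) f u = f b + f c.
Proof.
move=> uU bc bU cU f0; rewrite (bigD1_seq b)//=; congr (_ + _).
rewrite big_mkcond (bigD1_seq c)//= [X in X + _]ifT 1?eq_sym// big1 ?addr0// => v vc.
by case: eqVneq => // vb; exact: f0.
Qed.

Lemma sum_le_esum (R : realType) (T : choiceType) (f : T -> R) (U : seq T) :
  uniq U -> (forall v, 0 <= f v) ->
  ((\sum_(u <- U) f u)%:E <= \esum_(u in [set: T]) (f u)%:E)%E.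
Proof.
move=> uU f0; apply: esum_ge; exists [set` U]; first by split=> //; exact: finite_seq.
by rewrite -fsbig_seq// sumEFin.
Qed.

Theorem theorem3 (R : realType) (V : countType)
    (p : V -> V -> R) (hp : transition_probabilities p)
    (d0 : measure_display) (Omega : measurableType d0)
    (P : V -> probability Omega R) (X : nat -> Omega -> V)
    (hX : markov_chain p P X)
    (hirr : irreducible_chain P X) (hrec : recurrent_chain P X)
    (pi : V -> R) (hpi : stationary_vector p pi)
    (d : V -> nat) (succ : forall u, (d u).-tuple V)
    (hrotor : rotor_mechanism p succ)
    (b c : V) (hbc : b != c)
    (hK3 : K3 p d (hit_before P X b c) b c \is a fin_num)
    (x0 : V) (r0 : V -> nat) (hr0 : rotor_configuration d r0) (t : nat) :
  `| (visits (rotor_walk succ x0 r0) t b)%:R / pi b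
     - (visits (rotor_walk succ x0 r0) t c)%:R / pi c |
  <= fine (K3 p d (hit_before P X b c) b c)
     / (pi b * escape_probability P X b c).
Proof.
have [d_gt0 pE] := hrotor; have [pi_gt0 _] := hpi.
pose h := hit_before P X b c; pose x := rotor_walk succ x0 r0.
pose e := escape_probability P X b c.
have eE : e = successor_mean succ (hit_before P X c b) b.
  exact: (escape_probabilityE hX pE).
have e0 : 0 < e by rewrite eE (escape_gt0 hX pE).
have drift_b : drift succ h b = - e.
  rewrite /drift /h (hit_before_target hX)// eE.
  by rewrite -(mean_hit_before_return hX pE hrec hbc) opprD addrA subrr sub0r.
have drift_c : pi c * drift succ h c = pi b * e.
  rewrite /drift /h (hit_before_avoid hX) subr0 eE.
  by rewrite (stationary_escape hX pE d_gt0 hpi hrec hbc).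
have drift0 v : v != b -> v != c -> drift succ h v = 0.
  by move=> vb vc; rewrite /drift /h -(hit_before_harmonic hX pE)// subrr.
have h0 v : 0 <= h v by exact: hit_before_ge0.
have h1 v : h v <= 1 by exact: (hit_before_le1 hX).
have drift_le1 v : `|drift succ h v| <= 1.
  have := successor_mean_ge0 succ v h0; have := successor_mean_le1 succ d_gt0 v h1.
  by have := h0 v; have := h1 v; rewrite /drift ler_norml; lra.
pose gradient u := (d u)%:R * successor_mean succ (fun v => `|h u - h v|) u.
have gradient0 u : 0 <= gradient u by rewrite mulr_ge0// successor_mean_ge0.
pose S := (\esum_(u in [set: V]) (gradient u)%:E)%E.
(* Summing over the second vertex first turns each row of the double sum into a finite average over
   successors. *)
have K3E : K3 p d h b c = (1 + (2^-1)%:E * ((d b)%:R%:E + (d c)%:R%:E + S))%E.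
  rewrite /K3; congr (1 + _ * (_ + _))%E.
  have p0 u v : 0 <= p u v by rewrite pE divr_ge0.
  rewrite -[[set: V * V]](_ : [set: V] `*`` (fun=> [set: V]) = _); last by apply/seteqP.
  rewrite -(@esum_esum _ _ _ _ _ (fun u v => ((d u)%:R * p u v * `|h u - h v|)%:E)); last first.
    by move=> u v _ _; rewrite lee_fin !mulr_ge0.
  apply: eq_esum => u _; rewrite /gradient EFinM -(esum_transition pE)// -esumZl//.
    by apply: eq_esum => v _; rewrite -EFinM mulrA.
  by move=> v; rewrite lee_fin mulr_ge0.
have S0 : (0 <= S)%E by apply: esum_ge0 => u _; rewrite lee_fin.
have S_fin : S \is a fin_num.
  move: hK3; rewrite -/h K3E ge0_fin_numE ?adde_ge0 ?mule_ge0 ?lee_fin//.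
    move=> K3_fin; rewrite ge0_fin_numE// ltey; apply: contraTneq K3_fin => ->.
    by rewrite addey// gt0_muley ?lte_fin// addey.
  by rewrite !adde_ge0 ?lee_fin.
have fineK3 : fine (K3 p d h b c) = 1 + 2^-1 * ((d b)%:R + (d c)%:R + fine S).
  by rewrite K3E -(fineK S_fin).
(* Besides the vertices visited before [t], [U] includes [b] and [c], so that the drift terms sum to
   exactly two contributions. *)
have [U [uU bU cU xU]] : exists U : seq V,
    [/\ uniq U, b \in U, c \in U & forall s, (s < t)%N -> x s \in U].
  exists (undup (b :: c :: [seq x s | s <- iota 0 t])).
  rewrite undup_uniq !mem_undup !inE !eqxx orbT; split=> // s st.
  by rewrite mem_undup !inE map_f ?orbT// mem_iota.
have bound := rotor_drift_bound (h := h) (r0 := r0) d_gt0 hr0 _ uU xU.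
have {}bound : `|\sum_(s < t) drift succ h (x s)| <= fine (K3 p d h b c).
  apply: le_trans (bound _) _; first by move=> v; rewrite h0 h1.
  rewrite fineK3 lerD2l ler_pM2l ?invr_gt0// big_split/= [leRHS]addrC lerD//.
    rewrite -lee_fin (fineK S_fin).
    exact: (sum_le_esum uU gradient0).
  rewrite (sum_two_points uU hbc bU cU).
    by rewrite lerD// ler_piMr.
  by move=> v vb vc; rewrite drift0// normr0 mulr0.
have pib0 := pi_gt0 b; have pic0 := pi_gt0 c.
rewrite ler_pdivlMr ?mulr_gt0// -[X in _ * X]gtr0_norm ?mulr_gt0// -normrM.
apply: le_trans bound; rewrite (sum_visits _ _ hbc drift0) drift_b.
have -> : drift succ h c = pi b * e / pi c.
  by rewrite -drift_c mulrAC mulfV ?mul1r// gt_eqF.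
(* The accumulated drift is [- pi b * e] times the difference of the normalised visit counts, so the
   two absolute values coincide. *)
rewrite -/e -/x -normrN le_eqVlt; apply/orP; left; apply/eqP; congr (`|_|).
by field; rewrite !gt_eqF.
Qed.
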